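(* Let $\{K_t,\,t\ge0\}$ be the jump process on the torus described in the context, started from a point of $\mathbb T_{k_0}$, and let $h\in(0,t_* )$. The embedded Markov chain $\{K_{nh},\,n\ge0\}$ is Harris recurrent with respect to the measure $m_1$, i.e. for any Borel set $B\subset\mathbb T$ with $m_1[B]>0$ we have $$\mathbb P[\exists\,n\ge0:\ K_{nh}\in B]=1 .$$
   Context: $\mathbb T$ is the one dimensional torus, i.e. the interval $[-\pi,\pi]$ with endpoints identified, and $m_1(dk)=dk/(2\pi)$ is the normalized Lebesgue measure. The function $\hat r:\mathbb T\times\mathbb T\to\mathbb R$ is continuous, satisfies $r_0^{-1}\ge\hat r(\theta,k)\ge r_0$ for some $r_0>0$, is even: $\hat r(-\theta,-k)=\hat r(\theta,k)$, and doubly stochastic: $\int_{\mathbb T}\hat r(\theta,k)d\theta=\int_{\mathbb T}\hat r(k,\theta)d\theta=1$ for all $k\in\mathbb T$. The function $\gamma:\mathbb T\to[0,+\infty)$ is Borel and even ($\gamma(-k)=\gamma(k)$), there is $k_0\in\mathbb T$ with $\gamma(k_0)=0$ and $\inf\{\gamma(k):\ \mathrm{dist}(k,\{-k_0,k_0\})\ge\delta\}>0$ for every $\delta>0$ and $\gamma>0$ off $\{-k_0,k_0\}$; moreover $\gamma(k)\le t_*^{-1}$ for some $t_*>0$, and $\int_{\mathbb T}\gamma^{-1}(k)dk=+\infty$. Put $\mathbb T_{k_0}:=\mathbb T\setminus\{-k_0,k_0\}$. $\{K_t,\,t\ge0\}$ is the jump process on $\mathbb T$ with generator $Lf(k)=\gamma(k)\int_{\mathbb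 T}\hat r(\theta,k)[f(\theta)-f(k)]d\theta$ for bounded Borel $f$. It is realized as follows: $\{X_n\}$ is a Markov chain on $\mathbb T_{k_0}$ with transition probability from $k$ equal to $\hat r(\theta,k)d\theta$, $\{\rho_n\}$ is an independent i.i.d. sequence of exponential random variables of intensity $1$, $\tau(k,\rho):=\gamma^{-1}(k)\rho$, $t_0:=0$, $t_n:=\sum_{j=0}^{n-1}\tau(X_j,\rho_j)$, and $K_t:=X_n$ for $t\in[t_n,t_{n+1})$. *)

(* Defs.v *)
From HB Require Import structures.
From mathcomp Require Import all_boot all_order all_algebra.
From mathcomp Require Import all_classical all_reals all_analysis.

Set Implicit Arguments.
Unset Strict Implicit.
Unset Printing Implicit Defensive.

Import Order.TTheory GRing.Theory Num.Theory.
Import numFieldNormedType.Exports.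

Local Open Scope classical_set_scope.
Local Open Scope ring_scope.

Section torus.
Context {R : realType}.

(* The one-dimensional torus is R modulo 2 pi.  A point of it is represented by
   its unique representative in [-pi, pi[ (the endpoint pi being identified with
   -pi), a set of points by a subset of [-pi, pi[, and a function on it by a
   2 pi-periodic function on R, so that continuity and evenness of a function on
   the torus are those of its periodic extension. *)
Definition torus : set R := `[- pi, pi[%classic.

Definition torus_dist (k l : R) : R :=
  inf [set `|k - l + n%:~R * (2 * pi)| | n in [set: int]].

Definition torus_dist_set (k : R) (A : set R) : R :=
  inf [set torus_dist k l | l in A].

(* For k0 = -pi the real number -k0 = pi is not in [-pi, pi[, and only the point
   k0, which is then its own opposite on the torus, is removed. *)
Definition punctured_torus (k0 : R) : set R := torus `\` [set - k0; k0].

Definition m1 (B : set R) : \bar R :=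
  (((2 * pi)^-1)%:E * lebesgue_measure (B `&` torus))%E.

End torus.

Section processes.
Context {d : measure_display} {Omega : measurableType d} {R : realType}.
Variable P : probability Omega R.

Definition sigma_generated (X : nat -> Omega -> R) (I : set nat)
    : set (set Omega) :=
  <<s \bigcup_(i in I) preimage_set_system setT (X i) measurable >>.

(* A Markov chain on D with transition probability r theta k dtheta from k:
   for every Borel A `<=` D, the random variable
   w |-> \int_(theta in A) r theta (X_n w) dtheta is a version of the
   conditional probability of X_(n+1) \in A given sigma(X_0, ..., X_n). *)
Definition markov_chain (D : set R) (r : R -> R -> R) (X : nat -> Omega -> R)
    : Prop :=
  (forall n w, D (X n w)) /\
  forall (n : nat) (A : set R) (C : set Omega),
    measurable A -> A `<=` D ->
    sigma_generated X [set i | (i <= n)%N] C ->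
    P (C `&` X n.+1 @^-1` A) =
    (\int[P]_(w in C) \int[lebesgue_measure]_(theta in A)
       (r theta (X n w))%:E)%E.

Definition mutually_independent (X : nat -> Omega -> R) : Prop :=
  forall (J : seq nat) (B : nat -> set R), uniq J ->
    (forall j, j \in J -> measurable (B j)) ->
    P (\bigcap_(j in [set` J]) X j @^-1` B j) =
    (\prod_(j <- J) P (X j @^-1` B j))%E.

Definition independent_sequences (X Y : nat -> Omega -> R) : Prop :=
  forall C D : set Omega,
    sigma_generated X setT C -> sigma_generated Y setT D ->
    P (C `&` D) = (P C * P D)%E.

Definition iid_exponential (rho : nat -> {RV P >-> R}) : Prop :=
  mutually_independent (fun n => rho n) /\
  forall (n : nat) (A : set R), measurable A ->
    distribution P (rho n) A = exponential_prob 1 A.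

Definition jump_time (gamma : R -> R) (X rho : nat -> Omega -> R) (n : nat)
    (w : Omega) : R :=
  \sum_(j < n) (gamma (X j w))^-1 * rho j w.

(* K_t = X_n for t in [t_n, t_(n+1)[.  This is only required almost surely: on a
   null event the exponential variables may fail to be positive or the times t_n
   may stay bounded, and the t_n then do not determine K. *)
Definition jump_process (gamma : R -> R) (X rho : nat -> Omega -> R)
    (K : R -> Omega -> R) : Prop :=
  {ae P, forall w, forall (n : nat) (t : R), 0 <= t ->
     jump_time gamma X rho n w <= t < jump_time gamma X rho n.+1 w ->
     K t w = X n w}.

Definition harris_recurrent (D : set R) (m : set R -> \bar R)
    (Y : nat -> Omega -> R) : Prop :=
  forall B : set R, measurable B -> B `<=` D -> (0 < m B)%E ->
    P [set w | exists n, B (Y n w)] = 1%E.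

End processes.

(* Main.v *)
(* A holding time rho_i / gamma(X_i) with rho_i > 1 exceeds tstar > h, so its
   interval [t_i, t_(i+1)[ contains a multiple n h and K_(nh) = X_i.  It is thus
   enough that almost surely X_i \in B and rho_i > 1 for some i.  Each step puts
   X_i in B with conditional probability at least r0 |B|, independently of
   rho_i, so the probability of no success in N steps decays geometrically. *)
Require Import Defs.
From mathcomp Require Import all_boot all_order all_algebra.
From mathcomp Require Import all_classical all_reals all_analysis.
From mathcomp Require Import ring lra.

Set Implicit Arguments.
Unset Strict Implicit.

Import Order.TTheory GRing.Theory Num.Theory.
Import numFieldNormedType.Exports.

Local Open Scope classical_set_scope.
Local Open Scope ring_scope.

(* Compared with [ge0_le_integral], [f] need not be measurable. *)
Lemma cst_le_integral (d : measure_display) (T : measurableType d)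
    (R : realType) (mu : {measure set T -> \bar R}) (D : set T)
    (f : T -> \bar R) (c : R) :
  measurable D -> 0 <= c -> (forall x, D x -> c%:E <= f x)%E ->
  (c%:E * mu D <= \int[mu]_(x in D) f x)%E.
Proof.
move=> mD c0 cf; rewrite integral_mkcond ge0_integralTE; last first.
  move=> x; apply: erestrict_ge0 => y /cf; apply: le_trans.
  by rewrite lee_fin.
(* The integral is a supremum over nonnegative simple functions below the integrand; [c] times the
   indicator of [D] is one of them. *)
apply: ereal_sup_ubound; exists (scale_nnsfun (indic_nnsfun R mD) c0) => /=.
  move=> x; rewrite /= patchE -[measurable_realfun.mindic _ _ x]/(\1_D x).
  rewrite indicE; case: ifPn => xD.
    by rewrite mulr1; apply: cf; exact: set_mem.
  by rewrite mulr0.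
by rewrite sintegralrM /= sintegral_indic.
Qed.

(** * Events generated by a family of random variables *)

Section sigma_generated.
Context {d : measure_display} {Omega : measurableType d} {R : realType}.
Implicit Types (X : nat -> Omega -> R) (I : set nat) (C : set Omega).

Lemma sigma_generated_preimage X I i (A : set R) :
  I i -> measurable A -> sigma_generated X I (X i @^-1` A).
Proof.
move=> Ii mA; apply: sub_sigma_algebra; exists i => //.
by exists A => //; rewrite setTI.
Qed.

Lemma sub_sigma_generated X I1 I2 C :
  I1 `<=` I2 -> sigma_generated X I1 C -> sigma_generated X I2 C.
Proof. by move=> I12; apply: sub_sigma_algebra2 => ? [i /I12 ? ?]; exists i. Qed.

Lemma sigma_generated_measurable X I C :
  (forall i, measurable_fun setT (X i)) -> sigma_generated X I C -> measurable C.
Proof.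
move=> mX; apply: smallest_sub; first exact: sigma_algebra_measurable.
by move=> _ [i _ [A mA <-]]; exact: mX.
Qed.

Lemma sigma_generatedC X I C :
  sigma_generated X I C -> sigma_generated X I (~` C).
Proof. by rewrite -setTD; exact: sigma_algebraCD. Qed.

Lemma sigma_generatedI X I C1 C2 :
  sigma_generated X I C1 -> sigma_generated X I C2 ->
  sigma_generated X I (C1 `&` C2).
Proof. exact: (@measurableI _ (g_sigma_algebraType _)). Qed.

Lemma sigma_generatedT X I : sigma_generated X I setT.
Proof. exact: (@measurableT _ (g_sigma_algebraType _)). Qed.

Lemma sigma_generated_bigcap X I (J : seq nat) (A : set R) :
  (forall j, j \in J -> I j) -> measurable A ->
  sigma_generated X I (\bigcap_(j in [set` J]) X j @^-1` A).
Proof.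
move=> JI mA; rewrite bigcap_seq big_seq_cond.
elim/big_ind: _ => [|C1 C2|j /andP[jJ _]].
- exact: sigma_generatedT.
- exact: sigma_generatedI.
- by apply: sigma_generated_preimage => //; exact: JI.
Qed.

End sigma_generated.

(** * Geometric decay of the probability of no marked visit *)

Section visits_with_marks.
Context {d : measure_display} {Omega : measurableType d} {R : realType}.
Variables (P : probability Omega R) (X rho : nat -> {RV P >-> R}).
Variables (B V : set R) (beta s : R).
Hypotheses (mB : measurable B) (mV : measurable V).
Hypothesis X_visits : forall n C, sigma_generated X [set i | (i <= n)%N] C ->
  (beta%:E * P C <= P (C `&` X n.+1 @^-1` B))%E.
Hypothesis rho_indep : mutually_independent P (fun n => rho n).
Hypothesis rhoV : forall n, P (rho n @^-1` V) = s%:E.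
Hypothesis X_rho_indep : independent_sequences P X rho.

Let marked n := X n @^-1` B `&` rho n @^-1` (~` V).
(** The window starts at [n.+1], the first time that [X_visits] controls given the past up to
    [n]. *)
Let unmarked (n N : nat) :=
  \bigcap_(i in [set i | (n < i <= n + N)%N]) ~` marked i.
Let marksV (J : seq nat) := \bigcap_(j in [set` J]) rho j @^-1` V.
(** Bound for the probability that one step fails: a visit to [B] has conditional probability at
    least [beta], and its mark avoids [V] with probability [1 - s]. *)
Let q : R := 1 - beta * (1 - s).

Let sX_measurable I C : sigma_generated X I C -> measurable C.
Proof. by apply: sigma_generated_measurable => i; exact: measurable_funPT. Qed.

Let measurable_marked n : measurable (marked n).
Proof.
by apply: measurableI; apply: measurable_funPTI => //; exact: measurableC.
Qed.

Let measurable_unmarked n N : measurable (unmarked n N).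
Proof. by apply: bigcap_measurableType => // i _; exact: measurableC. Qed.

Let measurable_marksV J : measurable (marksV J).
Proof. by apply: bigcap_measurableType => // i _; exact: measurable_funPTI. Qed.

Let s_ge0 : 0 <= s.
Proof. by rewrite -lee_fin -(rhoV 0%N). Qed.

Let s_le1 : s <= 1.
Proof. by rewrite -lee_fin -(rhoV 0%N) probability_le1//; exact: measurable_funPTI. Qed.

Let beta_le1 : beta <= 1.
Proof.
have := @X_visits 0%N setT (@sigma_generatedT _ _ _ _ _).
rewrite probability_setT mule1 setTI -lee_fin => bP; apply: (le_trans bP).
by rewrite probability_le1//; exact: measurable_funPTI.
Qed.

Let q_ge0 : 0 <= q.
Proof. rewrite /q; have := s_ge0; have := s_le1; have := beta_le1; nra. Qed.

Let probability_marksV J : uniq J -> P (marksV J) = (s ^+ size J)%:E.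
Proof.
move=> uJ; rewrite /marksV (rho_indep (B := fun=> V)) //.
rewrite (eq_bigr (fun=> s%:E)) // => {uJ}.
elim: J => [|j J IH]; first by rewrite big_nil.
by rewrite big_cons IH /= exprS EFinM.
Qed.

(* Keeping [C] in the past of [X] and the event on [rho] in product form lets
   the Markov property and the independence of [X] and [rho] be used one at a
   time. *)
Let probability_unmarked N n C J :
  sigma_generated X [set i | (i <= n)%N] C -> uniq J ->
  (forall j, j \in J -> (j <= n)%N) ->
  (P (C `&` marksV J `&` unmarked n N) <= (q ^+ N * s ^+ size J)%:E * P C)%E.
Proof.
elim: N n C J => [|N IH] n C J nC uJ Jn.
  have mC := sX_measurable nC.
  (* The only use of the independence of [X] and [rho]: [C] and the event on the marks factor. *)
  rewrite expr0 mul1r -probability_marksV // muleC -X_rho_indep.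
  - apply: le_measure; rewrite ?inE; last exact: subIsetl.
    + by apply: measurableI => //; exact: measurableI.
    + exact: measurableI.
  - exact: sub_sigma_generated nC.
  - exact: sigma_generated_bigcap.
have nC' : sigma_generated X [set i | (i <= n.+1)%N] C.
  by apply: sub_sigma_generated nC => i /= /leqW.
have XB : sigma_generated X [set i | (i <= n.+1)%N] (X n.+1 @^-1` B).
  by apply: (@sigma_generated_preimage _ _ _ (fun n => X n)) => /=.
have CB := sigma_generatedI nC' XB.
have CNB := sigma_generatedI nC' (sigma_generatedC XB).
have [mCB mCNB] := (sX_measurable CB, sX_measurable CNB).
have mC := sX_measurable nC.
have Jn' j : j \in J -> (j <= n.+1)%N by move/Jn/leqW.
(* All indices in [J] are at most [n], so the mark of time [n.+1] is fresh. *)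
have uJ' : uniq (n.+1 :: J).
  by rewrite /= uJ andbT; apply/negP => /Jn; rewrite ltnn.
have Jn'' j : j \in n.+1 :: J -> (j <= n.+1)%N.
  by rewrite inE => /predU1P[->|/Jn'].
(* Split on whether [X n.+1] lies in [B]. If it does, being unmarked forces [rho n.+1] into [V], so
   [n.+1] joins [J] at the price of a factor [s]. *)
have IH1 := IH _ _ _ CNB uJ Jn'.
have IH2 := IH _ _ _ CB uJ' Jn''.
set E1 := (X in P X) in IH1; set E2 := (X in P X) in IH2.
have mE1 : measurable E1 by do 2 apply: measurableI => //.
have mE2 : measurable E2 by do 2 apply: measurableI => //.
apply: (@le_trans _ _ (P (E1 `|` E2))).
  apply: le_measure; rewrite ?inE.
  - by do 2 apply: measurableI => //.
  - exact: measurableU.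
  move=> w [[Cw Jw] Sw].
  have Sw' : unmarked n.+1 N w.
    move=> i /= /andP[ni iN]; apply: Sw => /=.
    by rewrite (ltn_trans (ltnSn n) ni) addnS -addSn.
  have [Bw|nBw] := pselect (B (X n.+1 w)); last by left.
  right; split => //; split => // j; rewrite /= inE => /predU1P[->|]; last exact: Jw.
  apply: contrapT => nV; apply: (Sw n.+1) => //=.
  by rewrite ltnSn /= addnS ltnS leq_addr.
apply: (le_trans (measureU2 _ mE1 mE2)).
apply: (le_trans (leeD IH1 IH2)).
have := X_visits nC.
have : P C = (P (C `&` X n.+1 @^-1` B) + P (C `&` ~` (X n.+1 @^-1` B)))%E.
  rewrite -measureU //.
    by rewrite -setIUr setUv setIT.
  by rewrite setIACA setICr setI0.
have /fineK <- := fin_num_measure P _ mCB.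
have /fineK <- := fin_num_measure P _ mCNB.
have /fineK <- := fin_num_measure P _ mC.
set b := fine (P (C `&` X n.+1 @^-1` B)); set a := fine (P (C `&` ~` _)).
move=> [->].
rewrite -!EFinM -EFinD !lee_fin /= !exprS => bac.
have : 0 <= q ^+ N * s ^+ size J by rewrite mulr_ge0 // exprn_ge0.
move: (q ^+ N) (s ^+ size J) => Q S QS.
(* Since [b >= beta * (a + b)], one has [a + s * b = (a + b) - (1 - s) * b <= q * (a + b)]. *)
rewrite (_ : _ + _ = Q * S * (a + s * b)); last by ring.
rewrite (_ : q * Q * S * _ = Q * S * (q * (b + a))); last by ring.
apply: ler_wpM2l => //; rewrite /q; have := s_le1; nra.
Qed.

(** Never being marked implies [unmarked 0 N] for every [N], so its probability is at most [q ^+ N],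
    which tends to 0 because [0 <= q < 1]. *)
Lemma ae_marked_visit : 0 < beta -> s < 1 ->
  {ae P, forall w, exists n, B (X n w) /\ ~ V (rho n w)}.
Proof.
move=> beta0 s1; exists (\bigcap_n ~` marked n); split.
- by apply: bigcap_measurableType => // i _; exact: measurableC.
- have mU : measurable (\bigcap_n ~` marked n).
    by apply: bigcap_measurableType => // i _; exact: measurableC.
  apply/eqP; rewrite eq_le measure_ge0 andbT.
  have le_q N : (P (\bigcap_n ~` marked n) <= (q ^+ N)%:E)%E.
    have := @probability_unmarked N 0 setT [::] (@sigma_generatedT _ _ _ _ _) isT.
    rewrite expr0 mulr1 probability_setT mule1 /marksV set_nil bigcap_set0 !setTI.
    move=> H; apply: (le_trans _ (H _)) => //; apply: le_measure; rewrite ?inE //.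
    by move=> w Uw i _; exact: Uw.
  have /fineK := fin_num_measure P _ mU => fP; rewrite -fP lee_fin.
  have q_lt1 : `|q| < 1 by rewrite ger0_norm // /q; nra.
  apply: (cvgr_to_ge (cvg_expr q_lt1)); apply: nearW => N.
  by rewrite -lee_fin fP.
- move=> w nw n _ [Bw Vw]; apply: nw; by exists n.
Qed.

End visits_with_marks.

(** * One-step visit bound and auxiliary facts *)

Lemma markov_chain_visit_ge (d : measure_display) (Omega : measurableType d)
    (R : realType) (P : probability Omega R) (D : set R) (r : R -> R -> R)
    (X : nat -> {RV P >-> R}) (r0 : R) (B : set R) (n : nat) (C : set Omega) :
  markov_chain P D r X -> 0 <= r0 -> (forall theta k, r0 <= r theta k) ->
  measurable B -> B `<=` D -> lebesgue_measure B \is a fin_num ->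
  sigma_generated X [set i | (i <= n)%N] C ->
  ((r0 * fine (lebesgue_measure B))%:E * P C <= P (C `&` X n.+1 @^-1` B))%E.
Proof.
move=> [_ Xr] r00 r0r mB BD finB nC; rewrite Xr //.
(* The inner integral is at least [r0] times the measure of [B] whatever the value of [X n w]; this
   constant is then integrated over [C]. *)
apply: cst_le_integral.
- apply: sigma_generated_measurable nC => i; exact: measurable_funPT.
- by rewrite mulr_ge0 // fine_ge0.
- move=> w _; rewrite EFinM fineK //; apply: cst_le_integral => // theta _.
  by rewrite lee_fin.
Qed.

Lemma exponential_prob_Nlt0 (R : realType) (rate : R) :
  exponential_prob rate `]-oo, 0[ = 0%E.
Proof.
apply: integral0_eq => x; rewrite /= in_itv /= => x0.
by rewrite lt0_exponential_pdf.
Qed.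

Lemma exists_multiple_between (R : realType) (h t : R) :
  0 < h -> 0 <= t -> exists n : nat, t <= n%:R * h <= t + h.
Proof.
(* The first multiple of [h] strictly beyond [t]; it overshoots by at most [h]. *)
move=> h0 t0; exists (Num.truncn (t / h)).+1.
have /truncn_itv/andP[le_th lt_th] : 0 <= t / h by rewrite divr_ge0 // ltW.
rewrite -ler_pdivrMr // (ltW lt_th) /= -addn1 natrD mulrDl mul1r lerD2r.
by rewrite -ler_pdivlMr.
Qed.

(** Allows [- k0] and [k0] to be removed from the target set without losing measure. *)
Lemma lebesgue_measureD_countable (R : realType) (A C : set R) :
  measurable A -> countable C ->
  lebesgue_measure (A `\` C) = lebesgue_measure A.
Proof.
move=> mA cC; have mC : measurable C by exact: countable_measurable.
rewrite [RHS](measureDI lebesgue_measure mA mC).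
rewrite [X in (_ + X)%E]countable_lebesgue_measure0 ?adde0 //.
by apply: sub_countable cC; apply: subset_card_le; exact: subIsetr.
Qed.

(** * Recurrence of the process sampled at multiples of [h] *)

Unset Implicit Arguments.
Theorem proposition4p1 (R : realType)
  (r : R -> R -> R) (r0 : R)
  (r_periodic1 : forall k, periodic (fun theta => r theta k) (2 * pi))
  (r_periodic2 : forall theta, periodic (fun k => r theta k) (2 * pi))
  (r_continuous : continuous (fun p : R * R => r p.1 p.2))
  (r0_gt0 : 0 < r0)
  (r_bounds : forall theta k, r0 <= r theta k <= r0^-1)
  (r_even : forall theta k, r (- theta) (- k) = r theta k)
  (r_stochastic1 : forall k,
    (\int[lebesgue_measure]_(theta in torus) (r theta k)%:E = 1)%E)
  (r_stochastic2 : forall k,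
    (\int[lebesgue_measure]_(theta in torus) (r k theta)%:E = 1)%E)
  (gamma : R -> R) (k0 tstar : R)
  (gamma_periodic : periodic gamma (2 * pi))
  (gamma_borel : measurable_fun setT gamma)
  (gamma_ge0 : forall k, 0 <= gamma k)
  (gamma_even : forall k, gamma (- k) = gamma k)
  (k0_torus : torus k0)
  (gamma_k0 : gamma k0 = 0)
  (gamma_inf : forall delta : R, 0 < delta ->
    (0 < ereal_inf [set (gamma k)%:E | k in
           [set k | torus k /\ (delta <= torus_dist_set k [set - k0; k0])%R]])%E)
  (gamma_gt0 : forall k, punctured_torus k0 k -> 0 < gamma k)
  (tstar_gt0 : 0 < tstar)
  (gamma_le : forall k, gamma k <= tstar^-1)
  (* the value 0^-1 = 0 occurs only at the two points -k0 and k0 *)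
  (gammaV_int : (\int[lebesgue_measure]_(k in torus) ((gamma k)^-1)%:E = +oo)%E)
  (d : measure_display) (Omega : measurableType d) (P : probability Omega R)
  (X rho : nat -> {RV P >-> R}) (K : R -> {RV P >-> R}) (x0 : R)
  (x0_torus : punctured_torus k0 x0)
  (X_start : P (X 0%N @^-1` [set x0]) = 1%E)
  (X_markov : markov_chain P (punctured_torus k0) r X)
  (rho_iid : iid_exponential rho)
  (X_rho_independent : independent_sequences P X rho)
  (K_jump : jump_process P gamma X rho K)
  (h : R) (h_bounds : 0 < h < tstar) :
  harris_recurrent P torus m1 (fun n => K (n%:R * h)).
Proof.
move=> B mB BT B0.
pose D := punctured_torus k0.
(* The Markov property is stated for Borel subsets of the punctured torus only. *)
pose B' := B `\` [set - k0; k0].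
have mk0 : measurable [set - k0; k0] by exact: measurableU.
have mB' : measurable B' by exact: measurableD.
have B'D : B' `<=` D by move=> x [/BT xT xk]; split.
have leb_B' : lebesgue_measure B' = lebesgue_measure (B `&` torus).
  by rewrite lebesgue_measureD_countable ?setIidl //; exact: finite_set_countable.
have leb_B'_gt0 : (0 < lebesgue_measure B')%E.
  rewrite leb_B'; apply: contraTT B0; rewrite -!leNgt /m1 => B0.
  by rewrite mule_ge0_le0 // lee_fin invr_ge0 mulr_ge0 // pi_ge0.
have fin_B' : lebesgue_measure B' \is a fin_num.
  rewrite ge0_fin_numE // (@le_lt_trans _ _ (lebesgue_measure (@torus R))) //.
    rewrite le_measure ?inE //; first exact: measurable_itv.
    by move=> x [/BT].
  by rewrite /torus lebesgue_measure_itv /=; case: ifP => _; rewrite ?ltry // -EFinD ltry.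
have rho01 n : P (rho n @^-1` `[0, 1]) = (1 - expR (-1))%:E.
  rewrite -[-1]mulr1 EFinB -exponential_prob_itv0c //.
  exact: (rho_iid.2 n _ (measurable_itv `[0, 1])).
(* Makes the jump times nonnegative, and turns a mark outside [[0, 1]] into a mark above 1. *)
have rho_ge0 : {ae P, forall w, forall n, 0 <= rho n w}.
  apply: ae_foralln => n; exists (rho n @^-1` `]-oo, 0[); split.
  - exact: measurable_funPTI.
  - rewrite -[RHS](exponential_prob_Nlt0 1).
    exact: (rho_iid.2 n _ (measurable_itv `]-oo, 0[)).
  - by move=> w /= /negP; rewrite in_itv /= -ltNge.
have long_visit : {ae P, forall w, exists n, B' (X n w) /\ ~ `[0, 1]%classic (rho n w)}.
  apply: (ae_marked_visit mB' _ _ rho_iid.1 rho01 X_rho_independent).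
  - exact: measurable_itv.
  - move=> n C nC; apply: (markov_chain_visit_ge X_markov (ltW r0_gt0)) => //.
    by move=> theta k; have /andP[] := r_bounds theta k.
  - by rewrite mulr_gt0 // fine_gt0 // leb_B'_gt0 ltey_eq fin_B'.
  - by rewrite ltrBlDr ltrDl expR_gt0.
(* Needed to pass from an almost sure statement to an event of probability 1. *)
have mE : measurable [set w | exists n : nat, B (K (n%:R * h) w)].
  rewrite (_ : mkset _ = \bigcup_n K (n%:R * h) @^-1` B); last first.
    by apply/seteqP; split => [w [n Bn]|w [n _ Bn]]; exists n.
  by apply: bigcupT_measurable => n; exact: measurable_funPTI.
have [h0 ht] := andP h_bounds.
suff aeE : {ae P, forall w, exists n : nat, B (K (n%:R * h) w)}.
  rewrite -[X in P X]setCK probability_setC; last exact: measurableC.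
  by rewrite (negligibleP _ _).1 ?sube0 //; exact: measurableC.
move: rho_ge0 long_visit K_jump; apply: filterS3 => w rho0 [i [[Bi _] /negP rhoi]] Kw.
have rho_gt1 : 1 < rho i w.
  by move: rhoi; rewrite /= in_itv /= rho0 /= -ltNge.
(* Positivity makes the inverse genuine and lets [gamma_le] be inverted below. *)
have gX_gt0 : 0 < gamma (X i w) by apply: gamma_gt0; exact: X_markov.1.
have ti_ge0 : 0 <= jump_time gamma (fun n => X n) (fun n => rho n) i w.
  by apply: sumr_ge0 => j _; rewrite mulr_ge0 // invr_ge0.
have [n /andP[tn nt]] := exists_multiple_between h0 ti_ge0.
exists n; rewrite (Kw i) //; first by rewrite mulr_ge0 // ltW.
(* It remains to see that the holding time exceeds [h]: [h < tstar * 1 <= (gamma (X i w))^-1 * rho i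
   w]. This also makes the upper bound strict. *)
rewrite tn (le_lt_trans nt) // /jump_time big_ord_recr /= ltrD2l.
apply: (lt_le_trans ht); rewrite -[leLHS]mulr1.
apply: ler_pM => //; [exact: ltW| |exact: ltW].
by rewrite -[leLHS]invrK lef_pV2 // posrE invr_gt0.
Qed.
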